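(* Let $S$ be a finite set of positive integers with $|S|\ge 2$, and let $o$ be the outcome function of the cumulative subtraction game $S$. Then $o$ is eventually periodic with period $2\max S$; that is to say, there is $N$ such that $o(x+2\max S)=o(x)$ for all $x\ge N$.
   Context: Cumulative subtraction (CS): $S$ is a finite set of positive integers with $|S|\ge 2$. Starting from a heap of $x\in\mathbb{Z}_{\ge 0}$ pebbles and score $0$, two players, Positive (who starts) and Negative, alternate in removing $s\in S$ pebbles, with $s$ at most the current heap size; Positive's move adds $s$ to the score and Negative's move subtracts $s$. The game ends when the heap is smaller than $\min S$. Positive maximizes and Negative minimizes the terminal score. Outcome function: $o:\mathbb{Z}_{\ge 0}\to\mathbb{Z}$ is defined recursively by $o(x)=0$ if $x<\min S$ and $o(x)=\max\{s-o(x-s)\mid s\in S,\ s\le x\}$ if $x\ge\min S$. Here ''eventually periodic with period $2\max S$'' means exactly the displayed property in the claim (no minimality of the period is asserted). *)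

(* Defs.v *)
From HB Require Import structures.
From mathcomp Require Import all_boot all_order all_algebra finmap.

Set Implicit Arguments.
Unset Strict Implicit.
Unset Printing Implicit Defensive.

Import Order.TTheory GRing.Theory Num.Theory.
Local Open Scope fset_scope.
Local Open Scope ring_scope.

Definition maxS (S : {fset nat}) : nat := (\max_(s <- S) s)%N.

(* Seeding with [maxS S] makes this the minimum of [S] whenever [S] is
   nonempty; see [minS_in] and [minS_le]. *)
Definition minS (S : {fset nat}) : nat := \big[minn/maxS S]_(s <- S) s.

(* The maximum of a nonempty list; 0 by convention on the empty list.  Seeding
   with the head keeps the value correct when all entries are negative. *)
Definition maxz (l : seq int) : int := \big[Num.max/head 0 l]_(z <- l) z.

(* [n] is fuel: as every move removes at least one pebble, [n > x] suffices. *)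
Fixpoint outcome_rec (S : {fset nat}) (n x : nat) : int :=
  if n is m.+1 then
    if (x < minS S)%N then 0
    else maxz [seq s%:Z - outcome_rec S m (x - s) | s <- S & (s <= x)%N]
  else 0.

(* The intended recursion is [outcome_lt] and [outcome_ge]. *)
Definition outcome (S : {fset nat}) (x : nat) : int := outcome_rec S x.+1 x.

Lemma maxS_le (S : {fset nat}) s : s \in S -> (s <= maxS S)%N.
Proof. by move=> sS; apply: (@leq_bigmax_seq _ _ xpredT id). Qed.

Lemma maxS_in (S : {fset nat}) : S != fset0 -> maxS S \in S.
Proof.
move=> /fset0Pn[s0 s0S].
have H (l : seq nat) : l != [::] -> (\max_(s <- l) s)%N \in l.
  elim: l => // a [|b l] IHl _; first by rewrite big_seq1 mem_head.
  rewrite big_cons; case: leqP => _; last exact: mem_head.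
  by rewrite in_cons IHl ?orbT.
apply: H; apply: contraTneq s0S => l0.
by rewrite -[s0 \in S]/(s0 \in enum_fset S) l0.
Qed.

Lemma minS_le (S : {fset nat}) s : s \in S -> (minS S <= s)%N.
Proof.
rewrite /minS; move: (maxS S) => m; rewrite -[s \in S]/(s \in enum_fset S).
elim: (enum_fset S) => // a l IHl.
rewrite in_cons big_cons geq_min => /orP[/eqP->|/IHl->]; last exact: orbT.
by rewrite leqnn.
Qed.

Lemma minS_in (S : {fset nat}) : S != fset0 -> minS S \in S.
Proof.
move=> /maxS_in mS; rewrite /minS big_seq_cond.
elim/big_ind: _ => [//|a b aS bS|s /andP[]//].
by rewrite /minn; case: ifP.
Qed.

Lemma maxz_ge (l : seq int) z : z \in l -> z <= maxz l.
Proof.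
rewrite /maxz; move: (head 0 l) => m.
elim: l => // a l IHl; rewrite in_cons big_cons le_max.
by case/orP=> [/eqP->|/IHl->]; rewrite ?lexx ?orbT.
Qed.

Lemma maxz_in (l : seq int) : l != [::] -> maxz l \in l.
Proof.
case: l => // a l _; rewrite /maxz big_seq_cond.
elim/big_ind: _ => [|b c bl cl|z /andP[]//]; first exact: mem_head.
by case: leP.
Qed.

Lemma outcome_rec_fuel (S : {fset nat}) n m x :
  (forall s, s \in S -> (0 < s)%N) -> (x < n)%N -> (x < m)%N ->
  outcome_rec S n x = outcome_rec S m x.
Proof.
move=> S0; elim: n m x => // n IHn [//|m] x; rewrite !ltnS => xn xm /=.
case: ifP => // _; congr maxz; apply/eq_in_map => s.
rewrite mem_filter => /andP[sx sS]; congr (_ - _).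
have xs : (x - s < x)%N.
  by rewrite ltn_subrL S0 //= (leq_trans (S0 _ sS) sx).
by apply: IHn; apply: leq_trans xs _.
Qed.

Lemma outcome_lt (S : {fset nat}) x : (x < minS S)%N -> outcome S x = 0.
Proof. by rewrite /outcome /= => ->. Qed.

Lemma outcome_ge (S : {fset nat}) x :
  (forall s, s \in S -> (0 < s)%N) -> (minS S <= x)%N ->
  outcome S x = maxz [seq s%:Z - outcome S (x - s) | s <- S & (s <= x)%N].
Proof.
move=> S0 mx; rewrite {1}/outcome /= ltnNge mx /=.
congr maxz; apply/eq_in_map => s.
rewrite mem_filter => /andP[sx sS]; congr (_ - _).
apply: outcome_rec_fuel => //.
by rewrite ltn_subrL S0 //= (leq_trans (S0 _ sS) sx).
Qed.

(* Main.v *)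
Require Import Defs.
From HB Require Import structures.
From mathcomp Require Import all_boot all_order all_algebra finmap.
From mathcomp Require Import zify.

Set Implicit Arguments.
Unset Strict Implicit.
Unset Printing Implicit Defensive.

Import Order.TTheory GRing.Theory Num.Theory.

(* With M = maxS S, let the heat of x be what the mover at x + M gains over
   removing M.  Replacing both optimal replies at x + M and at x by each other's
   shows that heat cannot drop along suitable descents.  From x of positive heat
   one therefore reaches, within 4M, some y that is hotter, or as hot with a
   larger residue mod 2M: when none of the descents increases the residue, both
   must jump over the peak of the tent function that the initial condition forces
   on the outcome, and the two overshoots are incompatible.  Heat and residue
   being bounded, the heat vanishes on all large heaps, and then
   o(x + 2M) = M - o(x + M) = o(x). *)

Lemma outcome_move (S : {fset nat}) s x :
  (forall t, t \in S -> 0 < t) -> s \in S -> s <= x ->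
  (s%:Z <= outcome S x + outcome S (x - s))%R.
Proof.
move=> S0 sS sx; rewrite -lerBlDr (outcome_ge S0 (leq_trans (minS_le sS) sx)).
by apply: maxz_ge; apply/mapP; exists s; rewrite // mem_filter sx.
Qed.

Lemma outcome_best (S : {fset nat}) x :
  (forall t, t \in S -> 0 < t) -> S != fset0 -> minS S <= x ->
  exists s, [/\ s \in S, s <= x & (s%:Z = outcome S x + outcome S (x - s))%R].
Proof.
move=> S0 Sn0 mx; rewrite (outcome_ge S0 mx).
set l := map _ _.
have /mapP[s] : maxz l \in l.
  apply: maxz_in; rewrite -size_eq0 size_map size_eq0 -has_filter.
  by apply/hasP; exists (minS S); first exact: minS_in.
rewrite mem_filter => /andP[sx sS] ->; exists s; split=> //.
by rewrite subrK.
Qed.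

(** The two bounds need each other: after the largest legal move [s], all legal moves are at most
    [s], so the reply is worth at most [s]; nonnegative replies in turn cap the outcome by the best
    move. *)
Lemma outcome_ge0_le (S : {fset nat}) x :
  (forall t, t \in S -> 0 < t) -> S != fset0 ->
  (0 <= outcome S x)%R /\
  forall B, (forall s, s \in S -> s <= x -> s <= B) -> (outcome S x <= B%:Z)%R.
Proof.
move=> S0 Sn0; elim/ltn_ind: x => x IHx.
have [mx|mx] := ltnP x (minS S); first by rewrite outcome_lt.
have exP : exists s, (s \in S) && (s <= x) by exists (minS S); rewrite minS_in.
have ubP s : (s \in S) && (s <= x) -> s <= x by case/andP.
have IH s : s \in S -> s <= x -> _ := fun sS sx => IHx (x - s) ltac:(have := S0 _ sS; lia).
split.
  case: (ex_maxnP exP ubP) => s /andP[sS sx] smax.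
  have le_s t : t \in S -> t <= x - s -> t <= s.
    by move=> tS tx; apply: smax; rewrite tS; lia.
  have [_ /(_ s le_s)] := IH s sS sx.
  by have := outcome_move S0 sS sx; lia.
move=> B HB; have [s [sS sx]] := outcome_best S0 Sn0 mx.
by have [? _] := IH s sS sx; have := HB s sS sx; lia.
Qed.

Lemma outcome_ge0 (S : {fset nat}) x :
  (forall t, t \in S -> 0 < t) -> S != fset0 -> (0 <= outcome S x)%R.
Proof. by move=> S0 Sn0; have [] := outcome_ge0_le x S0 Sn0. Qed.

Lemma outcome_le_maxS (S : {fset nat}) x :
  (forall t, t \in S -> 0 < t) -> S != fset0 ->
  (outcome S x <= (maxS S)%:Z)%R.
Proof.
move=> S0 Sn0; have [_] := outcome_ge0_le x S0 Sn0; apply=> s sS _.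
exact: maxS_le.
Qed.

(* The outcome lies below the rising halves and above the falling halves of the
   tent function of period [2 * maxS S].  This is where the initial condition
   enters: the recursion alone has solutions in which heat persists. *)
Lemma outcome_tent (S : {fset nat}) q r :
  (forall t, t \in S -> 0 < t) -> S != fset0 -> r < maxS S ->
  (outcome S (q * (2 * maxS S) + r) <= r%:Z)%R /\
  ((maxS S)%:Z <= outcome S (q * (2 * maxS S) + maxS S + r) + r%:Z)%R.
Proof.
move=> S0 Sn0; set M := maxS S => rM.
have step q' r' : r' < M -> (outcome S (q' * (2 * M) + r') <= r'%:Z)%R ->
    (M%:Z <= outcome S (q' * (2 * M) + M + r') + r'%:Z)%R.
  move=> r'M le; have := @outcome_move S M (q' * (2 * M) + M + r') S0 (maxS_in Sn0).
  have -> : q' * (2 * M) + M + r' - M = q' * (2 * M) + r' by lia.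
  by move=> /(_ ltac:(lia)); lia.
suff H : (outcome S (q * (2 * M) + r) <= r%:Z)%R by split=> //; exact: step.
elim: q r rM => [|q IHq] r rM.
  have [_] := outcome_ge0_le r S0 Sn0; rewrite mul0n add0n; exact.
set x := _ + r.
have [mx|mx] := ltnP x (minS S); first by rewrite outcome_lt.
have [s [sS sx E]] := outcome_best S0 Sn0 mx.
(* A move [s > r] lands on the falling half of the previous period, whose lower bound [s - r] caps
   the gain at [r]. *)
have [sr|rs] := leqP s r; first by have := outcome_ge0 (x - s) S0 Sn0; lia.
have sM := maxS_le sS; rewrite -/M in sM.
have r1M : M + r - s < M by lia.
have := step q _ r1M (IHq _ r1M).
have <- : x - s = q * (2 * M) + M + (M + r - s) by rewrite /x mulSn; lia.
by lia.
Qed.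

(* How much the mover at [x + maxS S] gains over the greedy move. *)
Definition heat (S : {fset nat}) (x : nat) : int :=
  (outcome S (x + maxS S) + outcome S x - (maxS S)%:Z)%R.

Lemma heat_ge0 (S : {fset nat}) x :
  (forall t, t \in S -> 0 < t) -> S != fset0 -> (0 <= heat S x)%R.
Proof.
move=> S0 Sn0; have := outcome_move S0 (maxS_in Sn0) (leq_addl x (maxS S)).
by rewrite addnK /heat; lia.
Qed.

Lemma heat_le_maxS (S : {fset nat}) x :
  (forall t, t \in S -> 0 < t) -> S != fset0 -> (heat S x <= (maxS S)%:Z)%R.
Proof.
move=> S0 Sn0; have := outcome_le_maxS x S0 Sn0.
by have := outcome_le_maxS (x + maxS S) S0 Sn0; rewrite /heat; lia.
Qed.

(* Optimal replies cross: [u] is optimal in the game at [x + maxS S], [s] in the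
   game at [x]; answering each by the other gives the pair of games at [y]. *)
Lemma heat_cross (S : {fset nat}) x y s u :
  (forall t, t \in S -> 0 < t) -> s \in S -> u \in S -> x = y + s + u ->
  (u%:Z = outcome S (x + maxS S) + outcome S (x + maxS S - u))%R ->
  (s%:Z = outcome S x + outcome S (x - s))%R ->
  (heat S x <= heat S y)%R /\
  (heat S x = heat S y -> u%:Z = outcome S (y + u) + outcome S y)%R.
Proof.
move=> S0 sS uS -> Eu Es.
have xu : y + s + u + maxS S - u = y + maxS S + s by lia.
have xs : y + s + u - s = y + u by lia.
rewrite /heat; rewrite xu in Eu; rewrite xs in Es.
have := outcome_move S0 sS (leq_addl (y + maxS S) s); rewrite addnK.
have := outcome_move S0 uS (leq_addl y u); rewrite addnK.
by split; lia.
Qed.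

(** A second exchange of replies: [u'] also leads from [y + u] to [z], and [u] from [z + maxS S] to
    [y + maxS S - u']. *)
Lemma heat_hold (S : {fset nat}) y z u u' :
  (forall t, t \in S -> 0 < t) -> u \in S -> u' \in S -> y + u = z + u' ->
  (u'%:Z = outcome S (y + maxS S) + outcome S (y + maxS S - u'))%R ->
  (u%:Z = outcome S (y + u) + outcome S y)%R ->
  (heat S y <= heat S z)%R.
Proof.
move=> S0 uS u'S yz Eu' Eu.
have := outcome_move S0 u'S (leq_addl z u'); rewrite addnK -yz.
have uM := maxS_le uS; have u'M := maxS_le u'S.
have := @outcome_move S u (z + maxS S) S0 uS ltac:(lia).
have <- : y + maxS S - u' = z + maxS S - u by lia.
by rewrite /heat; lia.
Qed.

Lemma heat_step (S : {fset nat}) x :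
  (forall t, t \in S -> 0 < t) -> S != fset0 -> 4 * maxS S <= x ->
  (0 < heat S x)%R ->
  exists y, [/\ x <= y + 4 * maxS S, (heat S x <= heat S y)%R &
    heat S x = heat S y -> x %% (2 * maxS S) < y %% (2 * maxS S)].
Proof.
move=> S0 Sn0; set M := maxS S => x4 hx.
have M0 : 0 < M by apply/S0/maxS_in.
have mM : minS S <= M by apply/minS_le/maxS_in.
have modE q r : r < 2 * M -> (q * (2 * M) + r) %% (2 * M) = r.
  by move=> rM; rewrite modnMDl modn_small.
have best z : M <= z -> exists s, [/\ s \in S, 0 < s <= M &
    (s%:Z = outcome S z + outcome S (z - s))%R].
  move=> Mz; have [s [sS _ E]] := outcome_best S0 Sn0 (leq_trans mM Mz).
  by exists s; rewrite S0 // maxS_le.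
have tight z s : (s%:Z = outcome S (z + M) + outcome S (z + M - s))%R ->
    (0 < heat S z)%R -> s != M.
  by rewrite /heat -/M => E hz; apply: contraTneq hz => sM; move: E; rewrite sM addnK; lia.
have f0 z := outcome_ge0 z S0 Sn0.
have [u [uS uM Eu]] := best (x + M) (leq_addl _ _).
have [s [sS sM Es]] := best x ltac:(lia).
have uneM := tight _ _ Eu hx.
(* Positive heat thus forces [s + u > M], so the descent from a residue [r < M] wraps around. *)
have usM : (heat S x <= u%:Z + s%:Z - M%:Z)%R.
  by have := f0 (x + M - u); have := f0 (x - s); rewrite /heat -/M; lia.
pose y := x - s - u.
have xy : x = y + s + u by rewrite /y; lia.
have [hxy Exy] := heat_cross S0 sS uS xy Eu Es.
have [E|/eqP hne] := eqVneq (heat S x) (heat S y); last by exists y; split=> //; lia.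
have {Exy} Eyu := Exy E.
have [q [r [rM xE]]] : exists q r, r < 2 * M /\ x = q * (2 * M) + r.
  by exists (x %/ (2 * M)), (x %% (2 * M)); rewrite ltn_mod -divn_eq; lia.
have xr : x %% (2 * M) = r by rewrite xE modE.
have [rltM|Mler] := ltnP r M.
  exists y; split=> // [|_]; first by lia.
  case: q xE => [|q] xE; first by lia.
  have -> : y = q * (2 * M) + (r + 2 * M - s - u) by move: xE; rewrite mulSn; lia.
  by rewrite xr modE; lia.
(* Otherwise [x - s] lies on the falling half, where the outcome exceeds [s] and makes [outcome S x]
   negative. *)
have sr : r - M < s.
  rewrite ltnNge; apply/negP => sr.
  have [_] := @outcome_tent S q (r - M - s) S0 Sn0 ltac:(rewrite -/M; lia).
  have <- : x - s = q * (2 * M) + M + (r - M - s) by lia.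
  by have := f0 x; lia.
have wrap t : 0 < t < M -> r < s + t -> x - s - t = q * (2 * M) + (r - s) - t ->
    r < (x - s - t) %% (2 * M).
  case: q xE => [|q] xE tM rst ->; first by lia.
  have -> : q.+1 * (2 * M) + (r - s) - t = q * (2 * M) + (2 * M + r - s - t).
    by rewrite mulSn; lia.
  by rewrite modE; lia.
have [rsu|sur] := ltnP r (s + u).
  by exists y; split=> // [|_]; [lia | rewrite xr; apply: wrap; lia].
(* Here [y] does not wrap around; the second candidate descends by an optimal reply [u'] at [y + M]
   instead of [u]. *)
have [u' [u'S u'M Eu']] := best (y + M) (leq_addl _ _).
have u'neM := tight _ _ Eu' ltac:(by rewrite -E).
pose z := x - s - u'.
have yz : y + u = z + u' by rewrite /z; lia.
have hyz := heat_hold S0 uS u'S yz Eu' Eyu.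
have [rsu'|su'r] := ltnP r (s + u').
  exists z; split=> [|//|_]; [by lia | by rewrite E | rewrite xr; apply: wrap; lia].
(* The tent bounds at [y + M] and [z] yield [M <= (r - s) + u' - u] and [M < (r - s) + u - u'];
   their sum contradicts [r - s < M]. *)
exfalso.
have [_] := @outcome_tent S q (r - s - u) S0 Sn0 ltac:(rewrite -/M; lia).
have <- : y + M = q * (2 * M) + M + (r - s - u) by lia.
have [+ _] := @outcome_tent S q (r - s - u') S0 Sn0 ltac:(rewrite -/M; lia).
have <- : z = q * (2 * M) + (r - s - u') by lia.
have := outcome_move S0 u'S (leq_addl z u'); rewrite addnK -yz.
have := f0 (y + M - u'); move: hx; rewrite E /heat -/M.
by lia.
Qed.

Lemma heat_eventually0 (S : {fset nat}) :
  (forall t, t \in S -> 0 < t) -> S != fset0 ->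
  exists N, forall x, N <= x -> heat S x = 0%R.
Proof.
move=> S0 Sn0; set M := maxS S.
have M0 : 0 < M by apply/S0/maxS_in.
(* Encodes the lexicographic order on heat, then residue. *)
pose key x := `|heat S x|%N * (2 * M) + x %% (2 * M).
have key_lt x : key x < M * (2 * M) + 2 * M.
  have hM : `|heat S x|%N <= M.
    by have := heat_le_maxS x S0 Sn0; have := heat_ge0 x S0 Sn0; rewrite -/M; lia.
  rewrite /key -addnS leq_add ?leq_mul2r ?hM ?orbT //.
  by rewrite ltn_mod; lia.
(* Each climb costs at most [4 * M] pebbles and raises [key]. *)
have climb n x : n * (4 * M) <= x -> (0 < heat S x)%R ->
    key x + n < M * (2 * M) + 2 * M.
  elim: n x => [|n IHn] x nx hx; first by rewrite addn0.
  have x4 : 4 * M <= x by move: nx; rewrite mulSn; lia.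
  have [y [xy hxy kxy]] := heat_step S0 Sn0 x4 hx.
  suff kk : key x < key y.
    by have := IHn y ltac:(move: nx; rewrite mulSn; lia) (lt_le_trans hx hxy); lia.
  rewrite /key; have [E|ne] := eqVneq (heat S x) (heat S y).
    by rewrite E ltn_add2l kxy.
  have hlt : `|heat S x|.+1 <= `|heat S y| by lia.
  apply: leq_trans (leq_addr _ _); apply: leq_trans (leq_mul hlt (leqnn _)).
  by rewrite mulSn addnC -addSn leq_add2r ltn_mod; lia.
exists ((M * (2 * M) + 2 * M) * (4 * M)) => x Nx.
have := heat_ge0 x S0 Sn0; rewrite le_eqVlt => /orP[/eqP//|/(climb _ _ Nx)].
by lia.
Qed.

Theorem corollary5 (S : {fset nat})
    (S_pos : forall s : nat, s \in S -> 0 < s)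
    (S_card : 2 <= #|` S|%fset) :
  exists N : nat, forall x : nat, N <= x ->
    outcome S (x + 2 * maxS S) = outcome S x.
Proof.
have Sn0 : S != fset0 by rewrite -cardfs_gt0; apply: ltn_trans S_card.
have [N HN] := heat_eventually0 S_pos Sn0; exists N => x Nx.
have := HN _ Nx; have := HN _ (leq_trans Nx (leq_addr (maxS S) x)).
have -> : x + 2 * maxS S = x + maxS S + maxS S by lia.
by rewrite /heat; lia.
Qed.
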